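(* For every integer $r \ge 3396$ with $r \equiv 0$ or $2 \pmod 3$ (that is, every admissible $r \ge 3396$ for $k=3$, $w=7$), there exists a $\mathrm{PENT}(3,r,7)$ of type D where each component of the deficiency graph has girth $4$.
   Context: A partial linear space is a (finite) set of points together with a set of lines, each line identified with the set of points incident with it, such that two distinct points lie on at most one common line. Two points are collinear if some line contains both (so a point that lies on a line is collinear with itself). A Steiner system $S(2,k,w)$ is a set of $w$ points with a collection of $k$-subsets (blocks) such that each pair of distinct points is contained in exactly one block. A generalized pentagonal geometry $\mathrm{PENT}(k,r,w)$ is a partial linear space in which every line has exactly $k$ points, every point is on exactly $r$ lines, and for every point $x$ the set of points not collinear with $x$ has size $w$ and is the point set of a Steiner system $S(2,k,w)$, denoted $x^{\mathrm{opp}}$, whose blocks are lines of the geometry. Its deficiency graph has the points of the geometry as vertices, with $x \sim y$ precisely when $x$ and $y$ are not collinear. Given $k$ and $w$, $r$ is admissible if $r(w+1-r) \equiv 0 \pmod k$. An opposite design pair in a $\mathrm{PENT}(k,r,w)$ is a pair of Steiner systems $S(2,k,w)$ with disjoint point sets, whose blocks are lines of the geometry, such that for each point $x$ of either system, $x^{\mathrm{opp}}$ is the other system. A generalized pentagonal geometry is of type D if its deficiency graph is not connected and has girth $4$, and the geometry does not contain an opposite design pair. *)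

(* Defs.v *)
From mathcomp Require Import all_boot all_algebra.
From mathcomp Require Import zify ring.

Set Implicit Arguments.
Unset Strict Implicit.
Unset Printing Implicit Defensive.

Record partial_linear_space (T : finType) := PartialLinearSpace {
  lines : {set {set T}};
  lines_meet : forall (x y : T) (l m : {set T}),
    l \in lines -> m \in lines -> x != y ->
    x \in l -> y \in l -> x \in m -> y \in m -> l = m
}.

Section Graph.
Variables (T : finType) (e : rel T).

Definition graph_connected : Prop := forall x y : T, connect e x y.

Definition component (x : T) : {set T} := [set y | connect e x y].

(* Cycles of the subgraph of [e] induced on [A]; the bound on the size excludes
   the degenerate closed walks of length 0, 1 and 2 that [ucycle] allows. *)
Definition graph_cycle (A : {set T}) (c : seq T) : Prop :=
  [/\ 2 < size c, {subset c <= A} & ucycle e c].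

Definition has_girth (A : {set T}) (g : nat) : Prop :=
  (exists2 c, graph_cycle A c & size c = g) /\
  (forall c, graph_cycle A c -> g <= size c).

End Graph.

Definition steiner_system (T : finType) (k w : nat)
    (V : {set T}) (B : {set {set T}}) : Prop :=
  [/\ #|V| = w,
      forall b, b \in B -> b \subset V /\ #|b| = k
    & forall x y, x \in V -> y \in V -> x != y ->
        exists! b, [/\ b \in B, x \in b & y \in b]].

Section Geometry.
Variables (T : finType) (G : partial_linear_space T).

Definition collinear : rel T :=
  fun x y => [exists l in lines G, (x \in l) && (y \in l)].

Definition deficiency_graph : rel T := fun x y => ~~ collinear x y.

(* The Steiner system with point set [V] and block set [B] is x^opp. *)
Definition is_opp (k w : nat) (x : T) (V : {set T}) (B : {set {set T}}) : Prop :=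
  [/\ V = [set y | ~~ collinear x y], B \subset lines G
    & steiner_system k w V B].

Definition PENT (k r w : nat) : Prop :=
  [/\ forall l, l \in lines G -> #|l| = k,
      forall x : T, #|[set l in lines G | x \in l]| = r
    & forall x : T, exists V B, is_opp k w x V B].

Definition opposite_design_pair (k w : nat)
    (V1 : {set T}) (B1 : {set {set T}})
    (V2 : {set T}) (B2 : {set {set T}}) : Prop :=
  [/\ steiner_system k w V1 B1 /\ B1 \subset lines G,
      steiner_system k w V2 B2 /\ B2 \subset lines G,
      [disjoint V1 & V2],
      forall x, x \in V1 -> is_opp k w x V2 B2
    & forall x, x \in V2 -> is_opp k w x V1 B1].

Definition type_D (k w : nat) : Prop :=
  [/\ ~ graph_connected deficiency_graph,
      has_girth deficiency_graph [set: T] 4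
    & ~ exists V1 B1 V2 B2, opposite_design_pair k w V1 B1 V2 B2].

End Geometry.

(* Over the integers: w + 1 - r is negative for large r. *)
Definition admissible (k w r : nat) : Prop :=
  (Posz k %| (Posz r * (Posz w + 1 - Posz r))%R)%Z.

Lemma admissible_3_7 (r : nat) :
  admissible 3 7 r <-> r = 0 %[mod 3] \/ r = 2 %[mod 3].
Proof.
rewrite /admissible; have := divn_eq r 3; have := ltn_pmod r (isT : 0 < 3).
move: (r %/ 3) (r %% 3) => q s lt_s3 ->.
have -> : (Posz (q * 3 + s) * (Posz 7 + 1 - Posz (q * 3 + s)) =
  Posz 3 * (Posz q * (8 - 3 * Posz q - 2 * Posz s)) + Posz s * (8 - Posz s))%R.
  by rewrite PoszD PoszM; ring.
by move: (Posz q * _)%R => m; case: s lt_s3 => [|[|[|//]]] _; lia.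
Qed.

(* Main.v *)
Require Import Defs.
From mathcomp Require Import all_boot all_algebra.
From mathcomp Require Import zify ring.

(** Write m = r + 4, so that the geometry must have 2m points. The geometry is
    handled through the ternary relation [tri x y z] saying that x, y, z are the
    three points of a line. What is asked of it can then be made local
    ([pentagonal]): the seven points opposite to x are closed under taking
    lines, x lies on a 4-cycle of the deficiency graph, and some two points
    opposite to x have different opposite sets, which keeps x out of every opposite
    design pair. Closure under lines makes two neighbours of x collinear, so
    the deficiency graph has no triangle and its girth is 4 in every component
    ([triple_geometry_type_D]).

    Because the conditions are local, the groups of a group divisible design
    with block size 3 may be filled with such relations: points of different
    groups are always collinear, so opposite sets are those of the fillings
    ([pentagonal_filled]). This also disconnects the deficiency graph as soon as
    there are two groups. The designs used have type (2n)^3 (2s)^1 with n odd and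
    s <= n: over a ring R of order n where 2 is invertible, the blocks
    (a, b, a + b, a + 2b) form a transversal design, its fourth group is
    truncated to s points, and each point is doubled by means of 3-GDDs of types
    2^3 and 2^4 ([design_triple]). Hence, if n and s are attained, so is 3n + s
    ([attained_truncated]).

    The starting values come from two copies of Z_n, the point i of one being
    opposite to i + d in the other for d in D = {0,1,2,5,6,10,17}. The set D
    carries a Fano plane that meets each of its translates in nothing, a point
    or a line, so the neighbourhoods have compatible Fano planes; a difference
    family supplies the remaining lines ([pentagonal_cyclic]).

    From twelve such n the rule 3n + s reaches every m >= 3072 with m not
    congruent to 2 modulo 3: a computation settles an initial interval, and from
    there on n and s can both be taken in the interval already reached
    ([reached_large]). *)

Set Implicit Arguments.
Unset Strict Implicit.
Unset Printing Implicit Defensive.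

(** * Triple relations with Fano planes as opposite sets *)

Section TripleRelation.
Variables (T : finType) (P : pred T) (tri : T -> T -> pred T).

Definition opposite : rel T :=
  fun x y => [&& P x, P y, x != y & [forall z, ~~ tri x y z]].

(** The structure lives on the subset [P] of the type so that the groups of a
    design need no types of their own. [opp_line] makes each opposite set a
    Fano plane, [opp_square] gives girth at most 4 locally, and [opp_split]
    excludes opposite design pairs. *)
Record pentagonal : Prop := Pentagonal {
  tri_dom : forall x y z, tri x y z -> P x;
  tri_swap : forall x y z, tri x y z -> tri y x z;
  tri_rot : forall x y z, tri x y z -> tri y z x;
  tri_neq : forall x y z, tri x y z -> x != y;
  tri_fun : forall x y z z', tri x y z -> tri x y z' -> z = z';
  opp_card : forall x, P x -> #|[pred y | opposite x y]| = 7;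
  opp_line : forall x y y', opposite x y -> opposite x y' -> y != y' ->
    exists2 z, tri y y' z & opposite x z;
  opp_square : forall x, P x -> exists y y' z,
    [/\ y != y', z != x & [/\ opposite x y, opposite x y',
      opposite z y & opposite z y']];
  opp_split : forall x, P x -> exists y y' z,
    [/\ opposite x y, opposite x y', opposite y z & ~~ opposite y' z]
}.

Hypothesis pent : pentagonal.

Lemma opp_sym : symmetric opposite.
Proof.
suff sub x y : opposite x y -> opposite y x by move=> x y; apply/idP/idP; apply: sub.
case/and4P=> Px Py neq_xy /forallP none; rewrite /opposite Px Py eq_sym neq_xy /=.
by apply/forallP=> z; apply/negP=> /(tri_swap pent); apply/negP.
Qed.

Lemma opp_irr : irreflexive opposite.
Proof. by move=> x; rewrite /opposite eqxx !andbF. Qed.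

Lemma opp_nexists x y z : opposite x y -> ~~ tri x y z.
Proof. by case/and4P=> _ _ _ /forallP. Qed.

Lemma tri_or_opp x y : P x -> P y -> x != y ->
  opposite x y \/ exists z, tri x y z.
Proof.
move=> Px Py neq_xy; case opp_xy: (opposite x y); first by left.
right; apply/existsP; move: opp_xy; rewrite /opposite Px Py neq_xy /=.
by move/negbT; rewrite negb_forall => /existsP[z]; rewrite negbK => ?; apply/existsP; exists z.
Qed.

End TripleRelation.

Section Transport.
Variables (T1 T2 : finType) (P1 : pred T1) (P2 : pred T2).
Variable tri : T1 -> T1 -> pred T1.
Variables (f : T1 -> T2) (h : T2 -> T1).
Hypothesis pent : pentagonal P1 tri.
Hypotheses (fP : forall x, P1 x -> P2 (f x)) (hP : forall y, P2 y -> P1 (h y)).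
Hypotheses (fK : forall x, P1 x -> h (f x) = x).
Hypotheses (hK : forall y, P2 y -> f (h y) = y).

Definition transported : T2 -> T2 -> pred T2 :=
  fun x y z => [&& P2 x, P2 y, P2 z & tri (h x) (h y) (h z)].

Let h_inj x y : P2 x -> P2 y -> (h x == h y) = (x == y).
Proof.
by move=> Px Py; apply/eqP/eqP=> [eq_h|-> //]; rewrite -(hK Px) eq_h hK.
Qed.

Let triP x y z : tri x y z -> [&& P1 x, P1 y & P1 z].
Proof.
move=> t; have t' := tri_rot pent t; have t'' := tri_rot pent t'.
by rewrite (tri_dom pent t) (tri_dom pent t') (tri_dom pent t'').
Qed.

Lemma opposite_transported x y : P2 x -> P2 y ->
  opposite P2 transported x y = opposite P1 tri (h x) (h y).
Proof.
move=> Px Py; rewrite /opposite Px Py !hP // h_inj //=.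
case: eqP => //= _; apply/forallP/forallP=> none z.
  apply/negP=> t; have /and3P[_ _ Pz] := triP t; move/negP: (none (f z)); apply.
  by rewrite /transported Px Py fP // fK.
by rewrite /transported Px Py /=; apply/negP=> /andP[_]; apply/negP.
Qed.

Let opp2 x y : opposite P2 transported x y -> P2 x /\ P2 y.
Proof. by case/and4P. Qed.

Let opp1 x y : opposite P1 tri x y -> P1 x /\ P1 y.
Proof. by case/and4P. Qed.

Lemma pentagonal_transported : pentagonal P2 transported.
Proof.
split.
- by move=> x y z /and4P[].
- by move=> x y z /and4P[Px Py Pz t]; rewrite /transported Px Py Pz (tri_swap pent).
- by move=> x y z /and4P[Px Py Pz t]; rewrite /transported Px Py Pz (tri_rot pent).
- by move=> x y z /and4P[Px Py Pz t]; rewrite -h_inj // (tri_neq pent t).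
- move=> x y z z' /and4P[_ _ Pz t] /and4P[_ _ Pz' t'].
  by rewrite -(hK Pz) (tri_fun pent t t') hK.
- move=> x Px; rewrite -(opp_card pent (hP Px)).
  rewrite -[RHS](card_in_image (f := f)); last first.
    move=> y y'; rewrite !inE => /opp1[_ Py] /opp1[_ Py'] eq_f.
    by rewrite -(fK Py) eq_f fK.
  apply: eq_card => y; apply/idP/imageP.
    move=> opp_xy; have [_ Py] := opp2 opp_xy.
    by exists (h y); rewrite ?hK // inE -opposite_transported.
  case=> y'; rewrite inE => opp_xy ->; have [_ Py] := opp1 opp_xy.
  by rewrite inE opposite_transported ?fP ?fK.
- move=> x y y' opp_xy opp_xy' neq; have [Px Py] := opp2 opp_xy.
  have [_ Py'] := opp2 opp_xy'; move: opp_xy opp_xy' neq.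
  rewrite !opposite_transported // -h_inj // => o o' neq.
  have [z t oz] := opp_line pent o o' neq; have [_ Pz] := opp1 oz.
  exists (f z); first by rewrite /transported Py Py' fP // fK.
  by rewrite opposite_transported ?fP ?fK.
- move=> x Px; have [y [y' [z [neq neq' [o1 o2 o3 o4]]]]] := opp_square pent (hP Px).
  have [[[_ Py] [_ Py']] [Pz _]] := (opp1 o1, opp1 o2, opp1 o3).
  exists (f y), (f y'), (f z); rewrite !opposite_transported ?fP ?fK //.
  by rewrite -!(h_inj (x := f _)) ?fP ?fK.
- move=> x Px; have [y [y' [z [o1 o2 o3 o4]]]] := opp_split pent (hP Px).
  have [[[_ Py] [_ Py']] [_ Pz]] := (opp1 o1, opp1 o2, opp1 o3).
  by exists (f y), (f y'), (f z); rewrite !opposite_transported ?fP ?fK.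
Qed.

End Transport.

Lemma pentagonal_empty (T : finType) (P : pred T) :
  #|P| = 0 -> pentagonal P (fun _ _ _ => false).
Proof.
move/eqP/pred0P=> P0; have P0' x : P x = false by exact: P0 x.
by split=> // x; rewrite /opposite ?P0' //=.
Qed.

(** The number of points is even because it is 2r + 8. *)
Definition attained (m : nat) : Prop :=
  exists (T : finType) (P : pred T) (tri : T -> T -> pred T),
    #|P| = m.*2 /\ pentagonal P tri.

(** Only the cardinality of the point set matters. *)
Lemma attained_on (m : nat) (T : finType) (P : pred T) :
  attained m -> #|P| = m.*2 -> exists tri, pentagonal P tri.
Proof.
case=> [T1 [P1 [tri [card1 pent]]]] card2.
case: (pickP P) => [x2 Px2|P0]; last first.
  by exists (fun _ _ _ => false); apply: pentagonal_empty; apply/eqP/pred0P.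
case: (pickP P1) => [x1 Px1|P0]; last first.
  have : #|P| = 0 by rewrite card2 -card1; apply/eqP/pred0P.
  by move/eqP/pred0P/(_ x2); rewrite /= Px2.
have eq12 : #|P1| = #|P| by rewrite card1 card2.
pose f x := enum_val (cast_ord eq12 (enum_rank_in Px1 x)).
pose h x := enum_val (cast_ord (esym eq12) (enum_rank_in Px2 x)).
exists (transported P tri h); apply: (@pentagonal_transported _ _ P1 P tri f h) => //.
- by move=> x _; apply: enum_valP.
- by move=> x _; apply: enum_valP.
- by move=> x Px; rewrite /f /h enum_valK_in cast_ordK enum_rankK_in.
- by move=> x Px; rewrite /f /h enum_valK_in cast_ordKV enum_rankK_in.
Qed.

(** * Filling the groups of a group divisible design *)

Section Filling.
Variables (T I : finType) (P : pred T) (grp : T -> I).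
Variables (cross : T -> T -> pred T) (inner : I -> T -> T -> pred T).
Hypothesis cross_dom : forall x y z, cross x y z -> P x.
Hypothesis cross_grp : forall x y z, cross x y z -> grp x != grp y.
Hypothesis cross_swap : forall x y z, cross x y z -> cross y x z.
Hypothesis cross_rot : forall x y z, cross x y z -> cross y z x.
Hypothesis cross_fun : forall x y z z', cross x y z -> cross x y z' -> z = z'.
Hypothesis cross_total : forall x y, P x -> P y -> grp x != grp y ->
  exists z, cross x y z.
Let block i := [pred x | P x && (grp x == i)].
Hypothesis inner_pent : forall i, pentagonal (block i) (inner i).

Definition filled : T -> T -> pred T :=
  fun x y z => if grp x == grp y then inner (grp x) x y z else cross x y z.

Let inner_grp i x y z : inner i x y z -> [/\ grp x = i, grp y = i & grp z = i].
Proof.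
move=> t; have t' := tri_rot (inner_pent i) t; have t'' := tri_rot (inner_pent i) t'.
have /andP[_ /eqP->] := tri_dom (inner_pent i) t.
have /andP[_ /eqP->] := tri_dom (inner_pent i) t'.
by have /andP[_ /eqP->] := tri_dom (inner_pent i) t''.
Qed.

Lemma opposite_filled x y :
  opposite P filled x y =
  (grp x == grp y) && opposite (block (grp x)) (inner (grp x)) x y.
Proof.
rewrite /opposite /filled /= eqxx; case: (eqVneq (grp x) (grp y)) => [->|neq].
  by rewrite ?eqxx !andbT.
apply/negP=> /and4P[Px Py _ /forallP none].
by have [z c] := cross_total Px Py neq; have := none z; rewrite c.
Qed.

Lemma opposite_block i x y :
  opposite (block i) (inner i) x y -> [/\ P x, grp x = i & grp y = i].
Proof. by case/and4P=> /= /andP[-> /eqP->] /andP[_ /eqP->]. Qed.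

(** Every pair of points from different groups is on a cross triple, hence an
    opposite set is entirely computed inside the group of its point. *)
Lemma pentagonal_filled : pentagonal P filled.
Proof.
have opp_i i x y : opposite (block i) (inner i) x y -> opposite P filled x y.
  by move=> o; have [_ gx gy] := opposite_block o; rewrite opposite_filled gx gy eqxx.
split.
- move=> x y z; rewrite /filled; case: ifP => _; last exact: cross_dom.
  by case/(tri_dom (inner_pent _))/andP.
- move=> x y z; rewrite /filled eq_sym; case: ifP => [/eqP->|_]; last exact: cross_swap.
  exact: tri_swap.
- move=> x y z; rewrite /filled; case: eqP => [_ t|_ c].
    by have [_ -> ->] := inner_grp t; rewrite eqxx; apply: tri_rot t.
  by have c' := cross_rot c; rewrite (negPf (cross_grp c')).
- move=> x y z; rewrite /filled; case: ifP => [_|/negP neq _]; first exact: tri_neq.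
  by apply/negP=> /eqP eq_xy; apply: neq; rewrite eq_xy.
- move=> x y z z'; rewrite /filled; case: ifP => _; first exact: tri_fun.
  exact: cross_fun.
- move=> x Px; have Bx : block (grp x) x by rewrite /= Px eqxx.
  rewrite -(opp_card (inner_pent _) Bx); apply: eq_card => y; rewrite !inE.
  rewrite opposite_filled; case: eqP => //= neq; apply/esym/negP.
  by case/opposite_block=> _ _ /esym.
- move=> x y y'; rewrite !opposite_filled => /andP[/eqP gy o] /andP[/eqP gy' o'] neq.
  have [z t oz] := opp_line (inner_pent _) o o' neq.
  by exists z; [rewrite /filled -gy -gy' eqxx | apply: opp_i oz].
- move=> x Px; have Bx : block (grp x) x by rewrite /= Px eqxx.
  have [y [y' [z [neq neq' [o1 o2 o3 o4]]]]] := opp_square (inner_pent _) Bx.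
  by exists y, y', z; split=> //; split; apply: opp_i; eassumption.
- move=> x Px; have Bx : block (grp x) x by rewrite /= Px eqxx.
  have [y [y' [z [o1 o2 o3 o4]]]] := opp_split (inner_pent _) Bx.
  have [_ _ gy'] := opposite_block o2.
  exists y, y', z; rewrite (opposite_filled y' z) gy' (negPf o4) andbF; split=> //.
  - exact: opp_i o1.
  - exact: opp_i o2.
  - exact: opp_i o3.
Qed.

End Filling.

(** * The geometry of a triple relation *)

Section Geometry.
Variables (T : finType) (tri : T -> T -> pred T).
Hypothesis pent : pentagonal predT tri.
Let opp := opposite predT tri.

Let triE x y z : tri x y z ->
  [/\ tri x z y, tri y x z, tri y z x, tri z x y & tri z y x].
Proof.
move=> t; have t1 := tri_rot pent t; have t2 := tri_rot pent t1.
by split=> //; apply: (tri_swap pent).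
Qed.

Definition triple_lines : {set {set T}} :=
  [set l | [exists x, exists y, exists z, tri x y z && (l == [set x; y; z])]].

Lemma triple_linesP l :
  reflect (exists x y z, tri x y z /\ l = [set x; y; z]) (l \in triple_lines).
Proof.
rewrite inE; apply: (iffP existsP) => [[x /existsP[y /existsP[z /andP[t /eqP->]]]]|].
  by exists x, y, z.
case=> x [y [z [t ->]]]; exists x; apply/existsP; exists y; apply/existsP; exists z.
by rewrite t eqxx.
Qed.

Lemma triple_line x y z : tri x y z -> [set x; y; z] \in triple_lines.
Proof. by move=> t; apply/triple_linesP; exists x, y, z. Qed.

(** Any two points of a line can be listed first, by the symmetry of [tri]. *)
Lemma triple_line_through l x y : l \in triple_lines -> x \in l -> y \in l ->
  x != y -> exists2 z, tri x y z & l = [set x; y; z].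
Proof.
case/triple_linesP=> a [b [c [t ->]]]; have [t1 t2 t3 t4 t5] := triE t.
rewrite !inE -!orbA => /or3P[] /eqP-> /or3P[] /eqP->; rewrite ?eqxx // => _.
- by exists c.
- by exists b => //; apply/setP=> u; rewrite !inE orbAC.
- by exists c => //; apply/setP=> u; rewrite !inE [(u == b) || _]orbC.
- by exists a => //; apply/setP=> u; rewrite !inE; do 3!case: (u == _).
- by exists b => //; apply/setP=> u; rewrite !inE; do 3!case: (u == _).
- by exists a => //; apply/setP=> u; rewrite !inE; do 3!case: (u == _).
Qed.

Lemma card_triple_line l : l \in triple_lines -> #|l| = 3.
Proof.
case/triple_linesP=> x [y [z [t ->]]]; have [t1 _ t3 _ _] := triE t.
rewrite setUC cardsU1 cards2 !inE (tri_neq pent t).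
by rewrite !(eq_sym z) (negPf (tri_neq pent t1)) (negPf (tri_neq pent t3)).
Qed.

Lemma triple_lines_meet x y l m : l \in triple_lines -> m \in triple_lines ->
  x != y -> x \in l -> y \in l -> x \in m -> y \in m -> l = m.
Proof.
move=> Ll Lm neq xl yl xm ym.
have [z t ->] := triple_line_through Ll xl yl neq.
have [z' t' ->] := triple_line_through Lm xm ym neq.
by rewrite (tri_fun pent t t').
Qed.

Definition triple_geometry := PartialLinearSpace triple_lines_meet.
Let G := triple_geometry.

Variable r : nat.
Hypotheses (r_gt0 : 0 < r) (cardT : #|T| = r.*2 + 8).

Let joined x := [set y | (y != x) && ~~ opp x y].

Let joinedP x y : reflect (exists z, tri x y z) (y \in joined x).
Proof.
rewrite inE; apply: (iffP andP) => [[neq nopp]|[z t]].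
  rewrite eq_sym in neq; case: (@tri_or_opp _ predT tri x y isT isT neq) => [o|[z t]]; last by exists z.
  by case/negP: nopp.
split; first by rewrite eq_sym (tri_neq pent t).
by apply/negP=> o; have := opp_nexists z o; rewrite t.
Qed.

Let card_joined x : #|joined x| = r.*2.
Proof.
have := cardsC (x |: [set y | opp x y]); rewrite cardT.
rewrite cardsU1 inE /opp opp_irr cardsE (opp_card pent (isT : predT x)).
suff -> : ~: (x |: [set y | opp x y]) = joined x by lia.
by apply/setP=> y; rewrite !inE negb_or.
Qed.

(** The lines through [x], with [x] deleted, partition the 2r points joined to
    [x] into pairs. *)
Lemma card_lines_through x : #|[set l in triple_lines | x \in l]| = r.
Proof.
set L := [set l in _ | _].
pose Q := [set l :\ x | l in L].
have card_Q : #|Q| = #|L|.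
  apply: card_in_imset => l m; rewrite !inE => /andP[_ xl] /andP[_ xm] eq_lm.
  by rewrite -(setD1K xl) eq_lm setD1K.
have partQ : partition Q (joined x).
  apply/and3P; split.
  - rewrite eqEsubset; apply/andP; split.
      apply/bigcupsP=> _ /imsetP[l /setIdP[Ll xl] ->].
      apply/subsetP=> y /setD1P[neq yl]; rewrite eq_sym in neq.
      by have [z t _] := triple_line_through Ll xl yl neq; apply/joinedP; exists z.
    apply/subsetP=> y /joinedP[z t]; apply/bigcupP.
    exists ([set x; y; z] :\ x).
      by apply/imsetP; exists [set x; y; z]; rewrite // !inE eqxx andbT; have := triple_line t; rewrite inE.
    by rewrite !inE eqxx orbT eq_sym (tri_neq pent t).
  - apply/trivIsetP=> _ _ /imsetP[l /setIdP[Ll xl] ->] /imsetP[m /setIdP[Lm xm] ->] neq.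
    rewrite -setI_eq0; apply: contraNT neq => /set0Pn[y].
    rewrite !inE => /andP[/andP[neq yl] /andP[_ ym]]; rewrite eq_sym in neq.
    by rewrite (triple_lines_meet Ll Lm neq xl yl xm ym).
  - apply/imsetP=> -[l /setIdP[Ll xl]] /esym eq0.
    by have := card_triple_line Ll; rewrite (cardsD1 x) xl eq0 cards0.
have := card_uniform_partition (n := 2) _ partQ; rewrite card_Q card_joined -muln2.
move=> H; apply/eqP; rewrite -(eqn_pmul2r (isT : 0 < 2)) H // => _ /imsetP[l /setIdP[Ll xl] ->].
by have := card_triple_line Ll; rewrite (cardsD1 x) xl => -[].
Qed.

Lemma deficiency_triple_geometry x y : deficiency_graph G x y = opp x y.
Proof.
rewrite /deficiency_graph /collinear /=; have [<-|neq] := eqVneq x y.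
  rewrite [opp _ _]opp_irr; apply/negbF/existsP.
  have : 0 < #|joined x| by rewrite card_joined; lia.
  case/card_gt0P=> u /joinedP[z t]; exists [set x; u; z].
  by rewrite triple_line // !inE eqxx.
apply/idP/idP=> [/existsPn none|o].
  case: (@tri_or_opp _ predT tri x y isT isT neq) => // -[z t].
  by have := none [set x; y; z]; rewrite triple_line // !inE !eqxx orbT.
apply/existsPn=> l; apply/negP=> /and3P[Ll xl yl].
have [z t _] := triple_line_through Ll xl yl neq.
by have := opp_nexists z o; rewrite t.
Qed.

Let noncollinear_set x : [set y | ~~ collinear G x y] = [set y | opp x y].
Proof. by apply/setP=> y; rewrite !inE -deficiency_triple_geometry. Qed.

Lemma is_opp_neighbours x V B : is_opp G 3 7 x V B -> V = [set y | opp x y].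
Proof. by case=> ->; rewrite noncollinear_set. Qed.

Lemma triple_PENT : PENT G 3 r 7.
Proof.
split=> [l|x|x]; [exact: card_triple_line | exact: card_lines_through |].
pose V := [set y | opp x y].
exists V, [set l in triple_lines | l \subset V]; split.
- by rewrite noncollinear_set.
- by apply/subsetP=> l /setIdP[].
split.
- by rewrite cardsE; apply: (opp_card pent).
- by move=> b /setIdP[Lb bV]; rewrite card_triple_line.
move=> y y'; rewrite !inE => o o' neq; have [z t oz] := opp_line pent o o' neq.
exists [set y; y'; z]; split.
  rewrite !inE !eqxx orbT; split=> //; apply/andP; split.
    by have := triple_line t; rewrite inE.
  by apply/subsetP=> u; rewrite !inE -orbA => /or3P[] /eqP->.
move=> b [/setIdP[Lb _] yb y'b]; have [z' t' ->] := triple_line_through Lb yb y'b neq.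
by rewrite (tri_fun pent t t').
Qed.

(** Two points opposite to the same point lie on a common line. *)
Lemma opp_triangle_free a b c : opp a b -> opp a c -> ~~ opp b c.
Proof.
move=> ab ac; have [<-|neq] := eqVneq b c; first by rewrite [opp _ _]opp_irr.
by have [z t _] := opp_line pent ab ac neq; apply/negP=> o; have := opp_nexists z o; rewrite t.
Qed.

Let opp_symm := opp_sym pent.

Lemma has_girth4 (A : {set T}) x : x \in A ->
  (forall y, connect (deficiency_graph G) x y -> y \in A) ->
  has_girth (deficiency_graph G) A 4.
Proof.
move=> xA connA; split; last first.
  move=> [|a [|b [|c [|d s]]]] // [_ _ /andP[cyc _]] //.
  move: cyc; rewrite /= !deficiency_triple_geometry => /and4P[ab bc ca _].
  rewrite [opp c a]opp_symm in ca.
  by have := opp_triangle_free ab ca; rewrite bc.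
have [y [y' [z [neq neqz [o1 o2 o3 o4]]]]] := opp_square pent (isT : predT x).
rewrite -/opp in o1 o2 o3 o4.
exists [:: x; y; z; y'] => //.
have e_opp a b : opp a b -> deficiency_graph G a b by rewrite deficiency_triple_geometry.
have [yx y'x] : opp y x /\ opp y' x by rewrite ![opp _ x]opp_symm.
have [yz y'z] : opp y z /\ opp y' z by rewrite ![opp _ z]opp_symm.
split=> //.
  move=> u; rewrite !inE => /or4P[] /eqP->; apply: connA => //.
  - exact/connect1/e_opp.
  - exact: connect_trans (connect1 (e_opp _ _ o1)) (connect1 (e_opp _ _ yz)).
  - exact/connect1/e_opp.
have neq_opp a b : opp a b -> a != b by case/and4P.
apply/andP; split; first by rewrite /= !deficiency_triple_geometry o1 yz o4 y'x.
rewrite /= !inE !negb_or (neq_opp _ _ o1) eq_sym neqz (neq_opp _ _ o2).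
by rewrite (neq_opp _ _ yz) neq (neq_opp _ _ o4).
Qed.

(** In an opposite design pair all points of one side have the same opposite
    set, which [opp_split] forbids. *)
Lemma no_opposite_design_pair :
  ~ exists V1 B1 V2 B2, opposite_design_pair G 3 7 V1 B1 V2 B2.
Proof.
case=> V1 [B1 [V2 [B2 [[[card1 _ _] _] _ _ opp1 opp2]]]].
have /card_gt0P[x xV1] : 0 < #|V1| by rewrite card1.
have [y [y' [z [o1 o2 o3 o4]]]] := opp_split pent (isT : predT x).
have V2E := is_opp_neighbours (opp1 x xV1).
have V1E u : opp x u -> V1 = [set y | opp u y].
  by move=> o; apply: (@is_opp_neighbours u _ B1); apply: opp2; rewrite V2E inE.
have : z \in V1 by rewrite (V1E y) // inE.
by rewrite (V1E y') // inE [opp _ _](negPf o4).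
Qed.

Lemma triple_geometry_type_D (I : eqType) (grp : T -> I) x0 y0 :
  (forall x y, opp x y -> grp x = grp y) -> grp x0 != grp y0 ->
  [/\ PENT G 3 r 7, type_D G 3 7 & forall x,
    has_girth (deficiency_graph G) (component (deficiency_graph G) x) 4].
Proof.
move=> grp_opp neq; split; first exact: triple_PENT.
  split; last exact: no_opposite_design_pair.
    move/(_ x0 y0)/connectP=> [p]; elim: p x0 neq => [|a p IH] x neq /=.
      by move=> _ eq_yx; rewrite eq_yx eqxx in neq.
    case/andP=> xa; apply: IH; rewrite -(grp_opp x a) //.
    by rewrite -deficiency_triple_geometry.
  by apply: (@has_girth4 _ x0) => // y _; rewrite inE.
by move=> x; apply: (@has_girth4 _ x) => [|y]; rewrite inE ?connect0.
Qed.

End Geometry.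

(** * A group divisible design with three equal groups and a smaller one *)

Notation index := (bool * bool)%type.
Notation fourth := ((true, true) : index).

Section Weight.

Notation wpoint := (index * bool)%type.

(** The eight nonzero vectors of F_3^2, in pairs {v, -v} indexed by the four
    directions. *)
Definition vec (x : wpoint) : nat * nat :=
  let: (i, p) := x in
  let: (a, b) := match i with
    | (false, false) => (1, 0) | (false, true) => (0, 1)
    | (true, false) => (1, 1) | (true, true) => (1, 2)
    end in
  if p then ((3 - a) %% 3, (3 - b) %% 3) else (a, b).

(** When [full], the triples are the lines of AG(2,3) missing the origin: they
    form a 3-GDD of type 2^4. Otherwise they form the addition table of Z_2 on
    the first three directions, a 3-GDD of type 2^3. *)
Definition weight_triple (full : bool) (x y z : wpoint) : bool :=
  [&& x.1 != y.1, y.1 != z.1, z.1 != x.1 &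
    if full then
      ((vec x).1 + (vec y).1 + (vec z).1 == 0 %[mod 3]) &&
      ((vec x).2 + (vec y).2 + (vec z).2 == 0 %[mod 3])
    else [&& x.1 != fourth, y.1 != fourth, z.1 != fourth & ~~ (x.2 (+) y.2 (+) z.2)]].

Lemma weight_triple_swap full x y z :
  weight_triple full x y z = weight_triple full y x z.
Proof.
by move: full x y z => [] [[[] []] []] [[[] []] []] [[[] []] []].
Qed.

Lemma weight_triple_rot full x y z :
  weight_triple full x y z = weight_triple full y z x.
Proof.
by move: full x y z => [] [[[] []] []] [[[] []] []] [[[] []] []].
Qed.

Definition weight_third (full : bool) (x y : wpoint) : wpoint :=
  head x [seq z <- [seq (i, p) | i <- [seq (a, b) | a <- [:: false; true],
    b <- [:: false; true]], p <- [:: false; true]] | weight_triple full x y z].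

Lemma weight_tripleE full x y z : x.1 != y.1 ->
  full || ((x.1 != fourth) && (y.1 != fourth)) ->
  weight_triple full x y z = (z == weight_third full x y).
Proof.
by move: full x y z => [] [[[] []] []] [[[] []] []] [[[] []] []].
Qed.

End Weight.

Section TruncatedDesign.
Import GRing.Theory.
Local Open Scope ring_scope.

Variables (R : finComNzRingType) (half : R) (Q : pred R).
Hypothesis half2 : half + half = 1.

(** Block (a, b) of the transversal design meets the groups in a, b, a + b and
    a + 2b. *)
Definition coordinate (i : index) (ab : R * R) : R :=
  match i with
  | (false, false) => ab.1
  | (false, true) => ab.2
  | (true, false) => ab.1 + ab.2
  | (true, true) => ab.1 + ab.2 + ab.2
  end.

Definition block_through (i j : index) (u v : R) : R * R :=
  match i, j with
  | (false, false), (false, true) => (u, v)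
  | (false, false), (true, false) => (u, v - u)
  | (false, false), _ => (u, half * (v - u))
  | (false, true), (false, false) => (v, u)
  | (false, true), (true, false) => (v - u, u)
  | (false, true), _ => (v - u - u, u)
  | (true, false), (false, false) => (v, u - v)
  | (true, false), (false, true) => (u - v, v)
  | (true, false), _ => (u - (v - u), v - u)
  | (true, true), (false, false) => (v, half * (u - v))
  | (true, true), (false, true) => (u - v - v, v)
  | (true, true), _ => (v - (u - v), u - v)
  end.

Let halfK (b : R) : half * b + half * b = b.
Proof. by rewrite -mulrDl half2 mul1r. Qed.

Lemma coordinateK i j ab : i != j ->
  block_through i j (coordinate i ab) (coordinate j ab) = ab.
Proof.
case: ab => a b.
have halfD : half * (a + b + b - a) = b.
  by rewrite -[RHS]halfK; ring.
by move: i j => [[] []] [[] []] //= _; rewrite ?halfD //; congr (_, _); ring.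
Qed.

Lemma block_throughK i j u v : i != j ->
  coordinate i (block_through i j u v) = u /\
  coordinate j (block_through i j u v) = v.
Proof.
have halfB (x y : R) : x + half * (y - x) + half * (y - x) = y.
  by rewrite -addrA halfK; ring.
by move: i j => [[] []] [[] []] //= _; split; rewrite ?halfB //; ring.
Qed.

Notation point := (index * R * bool)%type.

Definition in_design : pred point := fun x => (x.1.1 == fourth) ==> Q x.1.2.

Definition on_block (ab : R * R) (x : point) : bool :=
  x.1.2 == coordinate x.1.1 ab.

Definition weighted (x : point) := (x.1.1, x.2).

(** A block keeps its point in the fourth group exactly when that point
    satisfies [Q]; the weighting is by 2^4 or 2^3 accordingly. *)
Definition design_triple : point -> point -> pred point := fun x y z =>
  [exists ab, [&& on_block ab x, on_block ab y, on_block ab z &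
    weight_triple (Q (coordinate fourth ab)) (weighted x) (weighted y) (weighted z)]].

Lemma design_tripleP x y z :
  reflect (exists ab, [/\ on_block ab x, on_block ab y, on_block ab z &
    weight_triple (Q (coordinate fourth ab)) (weighted x) (weighted y) (weighted z)])
  (design_triple x y z).
Proof. by apply: (iffP existsP) => -[ab /and4P ?]; exists ab. Qed.

Lemma design_triple_swap x y z : design_triple x y z -> design_triple y x z.
Proof.
case/design_tripleP=> ab [ox oy oz w]; apply/design_tripleP; exists ab.
by rewrite weight_triple_swap.
Qed.

Lemma design_triple_rot x y z : design_triple x y z -> design_triple y z x.
Proof.
case/design_tripleP=> ab [ox oy oz w]; apply/design_tripleP; exists ab.
by rewrite -weight_triple_rot.
Qed.

Lemma design_triple_group x y z : design_triple x y z -> x.1.1 != y.1.1.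
Proof. by case/design_tripleP=> ab [_ _ _ /and4P[]]. Qed.

Lemma design_triple_dom x y z : design_triple x y z -> in_design x.
Proof.
case/design_tripleP=> ab [/eqP ox _ _ /and4P[_ _ _]].
rewrite /in_design ox; case: ifP => [Qab _|_ /and4P[/negPf-> //]].
by apply/implyP=> /eqP->.
Qed.

Lemma on_block_eq ab x y : x.1.1 != y.1.1 -> on_block ab x -> on_block ab y ->
  ab = block_through x.1.1 y.1.1 x.1.2 y.1.2.
Proof. by move=> neq /eqP-> /eqP->; rewrite coordinateK. Qed.

Lemma design_triple_weight ab x y : x.1.1 != y.1.1 ->
  on_block ab x -> on_block ab y -> in_design x -> in_design y ->
  forall w, weight_triple (Q (coordinate fourth ab)) (weighted x) (weighted y) w
    = (w == weight_third (Q (coordinate fourth ab)) (weighted x) (weighted y)).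
Proof.
move=> neq /eqP ox /eqP oy Px Py w; apply: weight_tripleE => //=.
case: (boolP (Q _)) => //= nQ; apply/andP; split.
  by apply: contra nQ => /eqP x4; move: Px; rewrite /in_design ox x4 eqxx.
by apply: contra nQ => /eqP y4; move: Py; rewrite /in_design oy y4 eqxx.
Qed.

Lemma design_triple_total x y : in_design x -> in_design y -> x.1.1 != y.1.1 ->
  exists z, design_triple x y z.
Proof.
move=> Px Py neq; pose ab := block_through x.1.1 y.1.1 x.1.2 y.1.2.
have [ox oy] := block_throughK x.1.2 y.1.2 neq; rewrite -/ab in ox oy.
have onx : on_block ab x by rewrite /on_block ox.
have ony : on_block ab y by rewrite /on_block oy.
pose w := weight_third (Q (coordinate fourth ab)) (weighted x) (weighted y).
exists (w.1, coordinate w.1 ab, w.2); apply/design_tripleP; exists ab; split=> //.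
  by rewrite /on_block.
by rewrite design_triple_weight // /weighted /= -surjective_pairing.
Qed.

Lemma design_triple_fun x y z z' :
  design_triple x y z -> design_triple x y z' -> z = z'.
Proof.
move=> t t'; have neq := design_triple_group t.
have Px := design_triple_dom t; have Py := design_triple_dom (design_triple_rot t).
case/design_tripleP: t => ab [ox oy oz w]; case/design_tripleP: t' => ab' [ox' oy' oz' w'].
have eq_ab : ab' = ab by rewrite (on_block_eq neq ox oy) (on_block_eq neq ox' oy').
subst ab'; move: w w'; rewrite !design_triple_weight // => /eqP w /eqP; rewrite -w.
case: z oz {w} => [[i u] p]; case: z' oz' {ox' oy'} => [[i' u'] p'] /eqP /= -> /eqP /= ->.
by case=> -> ->.
Qed.

Lemma card_design_group i :
  #|[pred x | in_design x && (x.1.1 == i)]| =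
  (if i == fourth then #|Q| else #|R|).*2.
Proof.
pose S := if i == fourth then Q else predT.
have -> : #|[pred x | in_design x && (x.1.1 == i)]|
    = #|predX (predX (pred1 i) S) (predT : pred bool)|.
  apply: eq_card => x; rewrite !inE /= /in_design andbT andbC /S.
  by case: eqP => //= ->; case: ifP.
rewrite cardX (cardX (pred1 i) S) card1 mul1n.
have -> : #|(xpredT : pred bool)| = 2%N by apply: card_bool.
rewrite muln2 /S.
by case: ifP.
Qed.

Lemma card_design : #|in_design| = (3 * #|R| + #|Q|).*2.
Proof.
rewrite -sum1_card (partition_big (fun x : point => x.1.1) predT) //=.
rewrite (eq_bigr (fun i => (if i == fourth then #|Q| else #|R|).*2)); last first.
  by move=> i _; rewrite -card_design_group -sum1_card; apply: eq_bigl.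
rewrite (bigD1 fourth) //= (eq_bigr (fun=> #|R|.*2)) => [|i /negPf-> //].
rewrite sum_nat_const.
have -> : #|[pred i : index | i != fourth]| = 3%N.
  by have := cardC (pred1 fourth); rewrite card1 card_prod card_bool => -[].
by rewrite -!muln2 mulnDl mulnA addnC.
Qed.

End TruncatedDesign.

(** The three groups on Z_n get a filling of size 2n and the truncated one a
    filling of size 2s; [grp] separates the components of the deficiency graph. *)
Lemma attained_truncated (n s : nat) : odd n -> 1 < n -> s <= n ->
  attained n -> attained s ->
  exists (T : finType) (tri : T -> T -> pred T) (grp : T -> index) (x y : T),
  [/\ #|T| = (3 * n + s).*2, pentagonal predT tri, grp x != grp y &
    forall x y, opposite predT tri x y -> grp x = grp y].
Proof.
move=> odd_n n_gt1 le_sn Sn Ss.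
pose R : finComNzRingType := 'Z_n; pose Q := [pred u : R | (u : nat) < s].
have nE : (Zp_trunc n).+2 = n by apply: Zp_cast.
have cardR : #|R| = n by rewrite card_ord nE.
have cardQ : #|Q| = s.
  rewrite -sum1_card (eq_bigl (fun u : 'I_(Zp_trunc n).+2 => (u : nat) < s)) //.
  have le_s : s <= (Zp_trunc n).+2 by rewrite nE.
  by rewrite (big_ord_narrow le_s) sum1_card card_ord.
(* Since n is odd, (n + 1) / 2 is the inverse of 2 modulo n. *)
pose half : R := (n.+1./2)%:R%R.
have half2 : (half + half = 1)%R.
  rewrite /half -GRing.natrD addnn halfK /= odd_n subn0 -GRing.natr1.
  by rewrite char_Zp // GRing.add0r.
have inner_ex i : exists tri : index * R * bool -> index * R * bool -> pred (index * R * bool),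
    pentagonal [pred x | in_design Q x && (x.1.1 == i)] tri.
  case: (eqVneq i fourth) => i4.
    by apply: (attained_on Ss); rewrite card_design_group i4 cardQ.
  by apply: (attained_on Sn); rewrite card_design_group (negPf i4) cardR.
have [inner inner_pent] := fin_all_exists inner_ex.
pose grp (x : index * R * bool) := x.1.1.
pose tri := filled grp (design_triple Q) inner.
have total := design_triple_total (Q := Q) half2.
have pent : pentagonal (in_design Q) tri.
  apply: pentagonal_filled inner_pent.
  - exact: design_triple_dom.
  - exact: design_triple_group.
  - exact: design_triple_swap.
  - exact: design_triple_rot.
  - exact: design_triple_fun half2.
  - exact: total.
pose T : finType := {x : index * R * bool | in_design Q x}.
have pP b : in_design Q ((b, false), 0%R, false) by case: b.
pose p b : T := exist (fun x => in_design Q x) _ (pP b).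
have in_designK x : in_design Q x -> val (insubd (p true) x : T) = x.
  by move=> Px; rewrite insubdK.
pose tri' := transported predT tri (val : T -> _).
exists T, tri', (fun x => grp (val x)), (p true), (p false); split=> //.
- by rewrite card_sig -cardQ -cardR card_design.
- apply: (@pentagonal_transported _ T (in_design Q) predT tri (insubd (p true)) val) => //.
  + by move=> x _; apply: valP.
  + by move=> x _; apply: valKd.
- move=> x y; rewrite (@opposite_transported _ T (in_design Q) predT tri (insubd (p true)) val) //.
  + by rewrite opposite_filled // => /andP[/eqP].
  + by move=> u _; apply: valP.
  + by move=> u _; apply: valKd.
Qed.

(** * Small geometries with a cyclic group *)

Section Cyclic.

(** All orderings of a block, so that the relation they generate is symmetric
    without further checks. *)
Definition orders (A : Type) (b : A * A * A) : seq (A * A * A) :=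
  let: (p, q, z) := b in
  [:: (p, q, z); (q, p, z); (p, z, q); (z, p, q); (q, z, p); (z, q, p)].

Lemma orders_swap (A : eqType) (b : A * A * A) p q z :
  (p, q, z) \in orders b -> (q, p, z) \in orders b.
Proof.
case: b => [[p0 q0] z0]; rewrite !inE !xpair_eqE -!andbA.
by move=> H; case: (p == p0) H; case: (p == q0); case: (p == z0); case: (q == p0);
  case: (q == q0); case: (q == z0); case: (z == p0); case: (z == q0); case: (z == z0).
Qed.

Lemma orders_rot (A : eqType) (b : A * A * A) p q z :
  (p, q, z) \in orders b -> (q, z, p) \in orders b.
Proof.
case: b => [[p0 q0] z0]; rewrite !inE !xpair_eqE -!andbA.
by move=> H; case: (p == p0) H; case: (p == q0); case: (p == z0); case: (q == p0);
  case: (q == q0); case: (q == z0); case: (z == p0); case: (z == q0); case: (z == z0).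
Qed.

Notation bpoint := (bool * nat)%type.
Notation triple := (bpoint * bpoint * bpoint)%type.

Definition opposite_shifts := [:: 0; 1; 2; 5; 6; 10; 17].

(** The Fano plane on the set D of opposite shifts, one line per translation
    class: {0,1,5}, {1,2,6} and {5,6,10} are translates of each other. *)
Definition fano_lines := [:: (0, 1, 5); (0, 17, 6); (2, 17, 5); (10, 17, 1); (0, 2, 10)].

(** The third point on the line of the plane D through [d] and [d'], where
    the line appears as the translate of a listed one by d - a. *)
Lemma fano_third d d' : d \in opposite_shifts -> d' \in opposite_shifts -> d != d' ->
  exists a b c d'', [/\ (a, b, c) \in flatten [seq orders l | l <- fano_lines],
    d'' \in opposite_shifts, a + d' = b + d & a + d'' = c + d].
Proof.
pose ok d d' := has (fun l : nat * nat * nat => (l.1.1 + d' == l.1.2 + d) &&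
  has (fun d'' => l.1.1 + d'' == l.2 + d) opposite_shifts)
  (flatten [seq orders l | l <- fano_lines]).
have : all (fun d => all (fun d' => (d == d') || ok d d') opposite_shifts)
  opposite_shifts by [].
move/allP=> H Dd Dd' neq; have /allP/(_ d' Dd') := H d Dd.
rewrite (negPf neq) /= => /hasP[[[a b] c] Ll /andP[/eqP e1 /hasP[d'' Dd'' /eqP e2]]].
by exists a, b, c, d''.
Qed.

Definition coloured (c : bool) (f : nat -> nat) (l : nat * nat * nat) : triple :=
  ((c, f l.1.1), (c, f l.1.2), (c, f l.2)).

(** Blocks containing the point 0 of one copy of Z_n, sorted by the number of
    points in the second copy. *)
Definition base_blocks (aaa aab abb bbb : seq (nat * nat)) : seq triple :=
  [seq ((false, 0), (false, l.1), (false, l.2)) | l <- aaa] ++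
  [seq ((false, 0), (false, l.1), (true, l.2)) | l <- aab] ++
  [seq ((false, 0), (true, l.1), (true, l.2)) | l <- abb] ++
  [seq ((true, 0), (true, l.1), (true, l.2)) | l <- bbb].

Variables (n : nat) (blocks : seq triple).

(** Points of the first copy are opposite to i + D, points of the second one to
    j - D: the Fano lines are D on the second copy and -D on the first. *)
Definition all_blocks : seq triple :=
  [seq coloured true id l | l <- fano_lines] ++
  [seq coloured false (subn n) l | l <- fano_lines] ++ blocks.

(** The block {0, n/3, 2n/3} has only n/3 translates; each difference is then
    listed once rather than three times. *)
Definition short_orders : seq triple :=
  let h := n %/ 3 in
  if 3 %| n then [:: coloured false id (0, h, h + h); coloured false id (0, h + h, h)]
  else [::].

Definition all_orders := flatten [seq orders b | b <- all_blocks] ++ short_orders.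

Definition difference (b : triple) : nat :=
  let: ((_, i), (_, j), _) := b in (j + (n - i %% n)) %% n.

Definition differences (c c' : bool) : seq nat :=
  [seq difference b | b <- all_orders & (b.1.1.1 == c) && (b.1.2.1 == c')].

(** The differences that no line may use: equal points, and opposite points. *)
Definition uncovered (c c' : bool) : seq nat :=
  if c == c' then [:: 0]
  else if c then [seq (n - d) %% n | d <- opposite_shifts] else opposite_shifts.

(** Each difference between the copies [c] and [c'] is used by exactly one
    ordering of one block, or is among the uncovered ones. The bound 17 < n keeps
    the elements of D distinct modulo n. *)
Definition difference_family : bool :=
  (17 < n) &&
  all (fun c => all (fun c' =>
    sort leq (uncovered c c' ++ differences c c') == iota 0 n)
    [:: false; true]) [:: false; true].

Hypothesis family : difference_family.

Let n_gt17 : 17 < n. Proof. by case/andP: family. Qed.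
Let n_gt1 : 1 < n. Proof. exact: leq_ltn_trans n_gt17. Qed.

Lemma perm_differences c c' :
  perm_eq (uncovered c c' ++ differences c c') (iota 0 n).
Proof.
case/andP: family => _ /allP/(_ c) H; have {}H := H ltac:(by case: (c)).
have /eqP <- := allP H c' ltac:(by case: (c')).
by rewrite perm_sym perm_sort.
Qed.

Let uniq_differences c c' : uniq (uncovered c c' ++ differences c c').
Proof. by rewrite (perm_uniq (perm_differences c c')) iota_uniq. Qed.

Lemma difference_inj b b' : b \in all_orders -> b' \in all_orders ->
  b.1.1.1 = b'.1.1.1 -> b.1.2.1 = b'.1.2.1 -> difference b = difference b' -> b = b'.
Proof.
move=> Ob Ob' eq1 eq2 eq_d.
have := uniq_differences b.1.1.1 b.1.2.1; rewrite cat_uniq => /and3P[_ _].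
rewrite /differences; set s := filter _ _.
have {Ob} : b \in s by rewrite mem_filter !eqxx.
have {Ob'} : b' \in s by rewrite mem_filter eq1 eq2 !eqxx.
elim: s => //= a s IH; rewrite !inE.
move=> /orP[/eqP eq_b'|sb'] /orP[/eqP eq_b|sb] /andP[Na u]; try subst a.
- by rewrite eq_b.
- by case/negP: Na; rewrite -eq_d map_f.
- by case/negP: Na; rewrite eq_d map_f.
- exact: IH.
Qed.

Import GRing.Theory.
Local Notation R := 'Z_n.
Notation point := (bool * R)%type.

Let valR (k : nat) : (k%:R%R : R) = k %% n :> nat.
Proof. exact: val_Zp_nat. Qed.

Let n0 : (n%:R = 0 :> R)%R. Proof. exact: char_Zp. Qed.

Let ltR (x : R) : x < n.
Proof. by have := ltn_ord x; rewrite [X in _ < X]Zp_cast. Qed.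

Let natR_sub k : k <= n -> ((n - k)%:R = - k%:R :> R)%R.
Proof. by move=> le_kn; rewrite natrB // n0 sub0r. Qed.

Let natR_mod k : ((k %% n)%:R = k%:R :> R)%R.
Proof. by apply: val_inj; rewrite /= !valR modn_mod. Qed.

Definition translate_of (b : triple) (x y z : point) : bool :=
  [&& x.1 == b.1.1.1, y.1 == b.1.2.1, z.1 == b.2.1,
    (y.2 - x.2 == b.1.2.2%:R - b.1.1.2%:R)%R &
    (z.2 - x.2 == b.2.2%:R - b.1.1.2%:R)%R].

Definition cyclic_triple : point -> point -> pred point :=
  fun x y z => has (fun b => translate_of b x y z) all_orders.

Lemma translate_difference b x y z : translate_of b x y z ->
  ((y.2 - x.2)%R : nat) = difference b.
Proof.
case: b => [[[c i] [c' j]] z0] /and5P[_ _ _ /eqP-> _] /=.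
by rewrite -valR natrD natR_sub ?natR_mod // ltnW // ltn_mod (ltn_trans _ n_gt1).
Qed.

Let difference_lt b : difference b < n.
Proof. by case: b => [[[c i] [c' j]] z0] /=; rewrite ltn_mod (ltn_trans _ n_gt1). Qed.

Lemma translate_exists (b : triple) (x y : point) : x.1 = b.1.1.1 -> y.1 = b.1.2.1 ->
  ((y.2 - x.2)%R : nat) = difference b -> exists z, translate_of b x y z.
Proof.
move=> eq1 eq2 eq_d.
exists (b.2.1, x.2 + (b.2.2%:R - b.1.1.2%:R))%R; rewrite /translate_of eq1 eq2 !eqxx /=.
rewrite [(x.2 + _ - x.2)%R]addrAC subrr add0r eqxx andbT; apply/eqP/val_inj.
move: eq_d; case: {eq1 eq2} b => [[[c i] [c' j]] z0] /= ->.
by rewrite -valR natrD natR_sub ?natR_mod // ltnW // ltn_mod (ltn_trans _ n_gt1).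
Qed.

Lemma orders_all b t : b \in all_blocks -> t \in orders b -> t \in all_orders.
Proof.
move=> Bb ob; rewrite mem_cat; apply/orP; left; apply/flattenP.
by exists (orders b); rewrite ?map_f.
Qed.

Let third0 : (3 %| n) -> let h : R := (n %/ 3)%:R%R in (h + h + h = 0)%R.
Proof.
move=> div3 h; rewrite -!natrD -[RHS]n0; congr (_%:R)%R.
by have := divnK div3; lia.
Qed.

(** For complete orbits this is the symmetry of [orders]; for the short orbit,
    with h = n/3, it comes from 3h = 0. *)
Lemma all_orders_closed b x y z : b \in all_orders -> translate_of b x y z ->
  cyclic_triple y x z /\ cyclic_triple y z x.
Proof.
rewrite mem_cat => /orP[/flattenP[_ /mapP[b0 Bb0 ->]]|].
  case: b => [[p q] w] ob tr; have mem := orders_all Bb0.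
  have {tr} /and5P[/= e1 e2 e3 /eqP e4 /eqP e5] := tr.
  have e45 : (z.2 - y.2 = w.2%:R - q.2%:R)%R.
    by transitivity ((z.2 - x.2) - (y.2 - x.2))%R; [ring | rewrite e4 e5; ring].
  have e4' : (x.2 - y.2 = p.2%:R - q.2%:R)%R by rewrite -opprB e4 opprB.
  split; apply/hasP.
    exists (q, p, w); first exact/mem/(orders_swap ob).
    by rewrite /translate_of /= e1 e2 e3 e4' e45 !eqxx.
  exists (q, w, p); first exact/mem/(orders_rot ob).
  by rewrite /translate_of /= e1 e2 e3 e4' e45 !eqxx.
rewrite /short_orders; case: ifP => // /[dup] div3 /third0.
set h := n %/ 3; move=> /= h3.
have mem1 : coloured false id (0, h, h + h) \in all_orders.
  by rewrite mem_cat /short_orders div3 !inE eqxx orbT.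
have mem2 : coloured false id (0, h + h, h) \in all_orders.
  by rewrite mem_cat /short_orders div3 !inE eqxx !orbT.
have hE : (- (h%:R : R) = h%:R + h%:R)%R.
  by apply/eqP; rewrite eq_sym -addr_eq0 h3.
have hhE : (- (h%:R + h%:R : R) = h%:R)%R by rewrite -hE opprK.
rewrite !inE => /orP[]/eqP->; rewrite /translate_of /= !natrD !subr0.
  case/and5P=> e1 e2 e3 /eqP e4 /eqP e5.
  have e45 : (z.2 - y.2 = h%:R)%R.
    by transitivity ((z.2 - x.2) - (y.2 - x.2))%R; [ring | rewrite e4 e5; ring].
  have e4' : (x.2 - y.2 = h%:R + h%:R)%R by rewrite -opprB e4 hE.
  by split; apply/hasP; [exists (coloured false id (0, h + h, h)) |
    exists (coloured false id (0, h, h + h))] => //;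
    rewrite /translate_of /= e1 e2 e3 e4' e45 !natrD !subr0 !eqxx.
case/and5P=> e1 e2 e3 /eqP e4 /eqP e5.
have e45 : (z.2 - y.2 = h%:R + h%:R)%R.
  by transitivity ((z.2 - x.2) - (y.2 - x.2))%R; [ring | rewrite e4 e5 -[RHS]hE; ring].
have e4' : (x.2 - y.2 = h%:R)%R by rewrite -opprB e4 hhE.
by split; apply/hasP; [exists (coloured false id (0, h, h + h)) |
  exists (coloured false id (0, h + h, h))] => //;
  rewrite /translate_of /= e1 e2 e3 e4' e45 !natrD !subr0 !eqxx.
Qed.

Definition shift (c : bool) (d : nat) : R := (if c then - d%:R else d%:R)%R.

Let shift_lt d : d \in opposite_shifts -> d < n.
Proof.
move=> Dd; apply: leq_ltn_trans n_gt17; move: d Dd; apply/allP; by [].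
Qed.

Lemma uncoveredP c (g : R) :
  reflect (exists2 d, d \in opposite_shifts & g = shift c d)
    ((g : nat) \in uncovered c (~~ c)).
Proof.
rewrite /uncovered; have -> : (c == ~~ c) = false by case: c.
case: c; apply: (iffP idP).
- case/mapP=> d Dd gE; exists d => //; apply: ord_inj; rewrite gE.
  by rewrite /shift -natR_sub ?valR // ltnW ?shift_lt.
- case=> d Dd ->; apply/mapP; exists d => //.
  by rewrite /shift -natR_sub ?valR // ltnW ?shift_lt.
- move=> Dg; exists (g : nat) => //; apply: ord_inj.
  by rewrite /shift valR modn_small.
- by case=> d Dd ->; rewrite /shift valR modn_small ?shift_lt.
Qed.

Lemma cyclic_tripleN (x y : point) : (y.2 - x.2 : R)%R \in
  [pred g : R | (g : nat) \in uncovered x.1 y.1] -> forall z, ~~ cyclic_triple x y z.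
Proof.
rewrite inE => Ug z; apply/hasP=> -[b Ob tr].
have := uniq_differences x.1 y.1; rewrite cat_uniq => /and3P[_ /hasP[]].
exists (nat_of_ord (y.2 - x.2 : R)%R) => //; rewrite (translate_difference tr).
by apply: map_f; rewrite mem_filter Ob andbT; case/and5P: tr => /eqP-> /eqP-> _ _ _; rewrite !eqxx.
Qed.

(** The differences are partitioned, so a pair without a line has an uncovered
    difference. *)
Lemma cyclic_oppositeP (x y : point) :
  reflect (exists2 d, d \in opposite_shifts & y = (~~ x.1, x.2 + shift x.1 d)%R)
    (opposite predT cyclic_triple x y).
Proof.
apply: (iffP idP) => [|[d Dd ->]]; last first.
  rewrite /opposite /=; apply/andP; split.
    by apply/eqP=> /(congr1 fst) /=; case: (x.1).
  apply/forallP; apply: cyclic_tripleN; rewrite inE.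
  by apply/(uncoveredP x.1); exists d => //=; ring.
case/and4P=> _ _ neq /forallP none.
have : ((y.2 - x.2)%R : nat) \in uncovered x.1 y.1 ++ differences x.1 y.1.
  by rewrite (perm_mem (perm_differences _ _)) mem_iota; apply: ltR.
rewrite mem_cat => /orP[U|/mapP[b]]; last first.
  rewrite mem_filter => /andP[/andP[/eqP e1 /eqP e2] Ob] gE.
  have [z tr] := translate_exists (esym e1) (esym e2) gE.
  by case/negP: (none z); apply/hasP; exists b.
case: (eqVneq y.1 (~~ x.1)) U => [eq_c|neq_c].
  rewrite eq_c => /uncoveredP[d Dd gE]; exists d => //.
  by rewrite -gE -eq_c addrC subrK -surjective_pairing.
have eq_c : x.1 = y.1 by case: (x.1) neq_c; case: (y.1).
rewrite /uncovered eq_c eqxx inE => /eqP g0.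
case/eqP: neq; rewrite [x]surjective_pairing [y]surjective_pairing eq_c; congr (_, _).
by apply/esym/eqP; rewrite -subr_eq0; apply/eqP/val_inj.
Qed.

Lemma cyclic_opposite c (u : R) d : d \in opposite_shifts ->
  opposite predT cyclic_triple (c, u) (~~ c, u + shift c d)%R.
Proof. by move=> Dd; apply/cyclic_oppositeP; exists d. Qed.

Let shift_inj c d d' : d < n -> d' < n -> shift c d = shift c d' -> d = d'.
Proof.
move=> lt_d lt_d' eq_s; rewrite -(modn_small lt_d) -(modn_small lt_d') -!valR.
by rewrite /shift in eq_s; case: c eq_s => [/oppr_inj|] ->.
Qed.

(** The 4-cycles come from the line {1,2,6} of D, which D shares with D + 1; the
    splitting from 2 being in D while 3 is not. *)
Lemma pentagonal_cyclic : pentagonal predT cyclic_triple.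
Proof.
split=> //.
- by move=> x y z /hasP[b Ob /(all_orders_closed Ob)[]].
- by move=> x y z /hasP[b Ob /(all_orders_closed Ob)[]].
- move=> x y z t; apply/negP=> /eqP eq_xy; subst y; move: t; apply/negP.
  by apply: cyclic_tripleN; rewrite inE /uncovered eqxx subrr.
- move=> x y z z' /hasP[b Ob tr] /hasP[b' Ob' tr'].
  have eq_b : b = b'.
    case/and5P: (tr) => /eqP e1 /eqP e2 _ _ _; case/and5P: (tr') => /eqP e1' /eqP e2' _ _ _.
    apply: difference_inj => //; first by rewrite -e1 e1'.
      by rewrite -e2 e2'.
    by rewrite -(translate_difference tr) (translate_difference tr').
  subst b'; case/and5P: tr => _ _ /eqP e3 _ /eqP e5.
  case/and5P: tr' => _ _ /eqP e3' _ /eqP e5'.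
  rewrite [z]surjective_pairing [z']surjective_pairing e3 e3'; congr (_, _).
  by apply: (addIr (- x.2)%R); rewrite e5.
- move=> x _; pose f d : point := (~~ x.1, x.2 + shift x.1 d)%R.
  transitivity (size [seq f d | d <- opposite_shifts]) => //.
  have /card_uniqP <- : uniq [seq f d | d <- opposite_shifts].
    rewrite map_inj_in_uniq // => d d' Dd Dd' /(congr1 snd) /addrI.
    by apply: shift_inj; apply: shift_lt.
  apply: eq_card => y; rewrite inE; apply/cyclic_oppositeP/mapP => -[d Dd ->]; exists d => //.
- move=> x y y' /cyclic_oppositeP[d Dd ->] /cyclic_oppositeP[d' Dd' ->] neq.
  have neq_d : d != d' by apply: contraNneq neq => ->.
  have [a [b [c [d'' [Lo Dd'' e1 e2]]]]] := fano_third Dd Dd' neq_d.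
  exists (~~ x.1, x.2 + shift x.1 d'')%R; last by apply/cyclic_oppositeP; exists d''.
  have E1 : (a%:R + d'%:R = b%:R + d%:R :> R)%R by rewrite -!natrD e1.
  have E2 : (a%:R + d''%:R = c%:R + d%:R :> R)%R by rewrite -!natrD e2.
  have D1 : (d'%:R - d%:R = b%:R - a%:R :> R)%R.
    by transitivity (a%:R + d'%:R - d%:R - a%:R : R)%R; [ring | rewrite E1; ring].
  have D2 : (d''%:R - d%:R = c%:R - a%:R :> R)%R.
    by transitivity (a%:R + d''%:R - d%:R - a%:R : R)%R; [ring | rewrite E2; ring].
  pose col := if x.1 then coloured false (subn n) else coloured true id.
  apply/hasP; exists (col (a, b, c)).
    have /flattenP[_ /mapP[l Fl ->] ol] := Lo.
    have ocol : col (a, b, c) \in orders (col l).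
      rewrite /col; case: l ol {Fl} => [[l1 l2] l3]; rewrite !inE.
      by case: (x.1) => /or4P[/eqP[-> -> ->]|/eqP[-> -> ->]|/eqP[-> -> ->]|/or3P[]/eqP[-> -> ->]];
        rewrite /= !inE !eqxx ?orbT.
    apply: orders_all ocol; rewrite /all_blocks /col !mem_cat.
    by case: (x.1); rewrite map_f ?orbT.
  have lines_le : all (fun l : nat * nat * nat => [&& l.1.1 <= 17, l.1.2 <= 17 & l.2 <= 17])
    (flatten [seq orders l | l <- fano_lines]) by [].
  have /and3P[a17 b17 c17] := allP lines_le _ Lo.
  have le_n k : k <= 17 -> k <= n by move=> /leq_trans; apply; apply: ltnW.
  rewrite /translate_of /shift /col; case: (x.1) => /=.
    rewrite !natR_sub ?le_n //; apply/andP; split; apply/eqP.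
      by transitivity (- (d'%:R - d%:R) : R)%R; [ring | rewrite D1; ring].
    by transitivity (- (d''%:R - d%:R) : R)%R; [ring | rewrite D2; ring].
  by apply/andP; split; apply/eqP; [rewrite -D1 | rewrite -D2]; ring.
- move=> [c u] _.
  exists (~~ c, u + shift c 1)%R, (~~ c, u + shift c 2)%R, (c, u + shift c 1)%R.
  have s2 : shift c 2 = (shift c 1 + shift c 1)%R.
    by rewrite /shift; case: (c); rewrite ?mulr2n; ring.
  have s0 : shift c 0 = 0%R by rewrite /shift; case: (c); rewrite ?oppr0.
  have s_neq d d' : d < n -> d' < n -> d != d' -> shift c d != shift c d'.
    by move=> lt_d lt_d'; apply: contraNneq => /shift_inj->.
  split.
  - apply/eqP=> /(congr1 snd) /addrI/eqP; apply/negP; apply: s_neq => //; exact: ltn_trans n_gt17.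
  - apply/eqP=> /(congr1 snd) /= /eqP; rewrite -subr_eq0 addrAC subrr add0r -s0; apply/negP.
    by apply: s_neq => //; apply: ltn_trans n_gt17.
  have opp v v' d : d \in opposite_shifts -> v' = (v + shift c d)%R ->
      opposite predT cyclic_triple (c, v) (~~ c, v').
    by move=> Dd ->; apply: cyclic_opposite.
  split.
  + exact: (opp u _ 1).
  + exact: (opp u _ 2).
  + by apply: (opp _ _ 0) => //; rewrite s0 addr0.
  + by apply: (opp _ _ 1) => //; rewrite s2 addrA.
- move=> [c u] _.
  exists (~~ c, u + shift c 0)%R, (~~ c, u + shift c 1)%R, (c, u - shift c 2)%R.
  have sN d : shift (~~ c) d = (- shift c d)%R by rewrite /shift; case: (c); rewrite ?opprK.
  have s0 : shift c 0 = 0%R by rewrite /shift; case: (c); rewrite ?oppr0.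
  have s3 : shift c 3 = (shift c 2 + shift c 1)%R.
    by rewrite /shift; case: (c); rewrite -?opprD -natrD.
  split.
  - by apply/cyclic_oppositeP; exists 0.
  - by apply/cyclic_oppositeP; exists 1.
  - by apply/cyclic_oppositeP; exists 2; rewrite //= negbK sN s0 addr0.
  apply/cyclic_oppositeP=> -[d Dd] /(congr1 snd) /=; rewrite sN => eq_u.
  have eq3 : shift c d = shift c 3.
    rewrite s3; transitivity (u + shift c 1 - (u + shift c 1 - shift c d))%R; first by ring.
    by rewrite -eq_u; ring.
  have lt3 : 3 < n by apply: ltn_trans n_gt17.
  by have d3 := shift_inj (shift_lt Dd) lt3 eq3; rewrite d3 in Dd.
Qed.

Lemma attained_cyclic : attained n.
Proof.
exists point, predT, cyclic_triple; split; last exact: pentagonal_cyclic.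
by rewrite card_prod card_bool card_ord Zp_cast // mul2n.
Qed.

End Cyclic.

(** * Twelve difference families *)

(** Nothing distinguishes these blocks among the many completions of the Fano
    orbits to a difference family. *)
Definition base55 := base_blocks
  [::]
  [:: (13, 22); (18, 8); (20, 38); (21, 47); (25, 49); (27, 41); (29, 4);
    (31, 51); (32, 29); (33, 12); (36, 43); (41, 32)]
  [:: (3, 44); (11, 33); (15, 35); (21, 42); (25, 48); (27, 54); (31, 50);
    (36, 23); (37, 19); (39, 13); (40, 16); (53, 28)]
  [::].

Definition base57 := base_blocks
  [::]
  [:: (21, 48); (23, 36); (25, 39); (26, 56); (27, 16); (29, 26); (33, 21);
    (35, 53); (37, 20); (39, 37); (43, 15); (44, 22)]
  [:: (3, 47); (4, 38); (7, 34); (11, 44); (12, 32); (19, 33); (23, 52);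
    (24, 42); (28, 49); (31, 50); (41, 9); (43, 8); (51, 25)]
  [::].

Definition base63 := base_blocks
  [:: (20, 33)]
  [:: (18, 43); (24, 32); (26, 37); (29, 58); (31, 19); (35, 27); (36, 39);
    (38, 62); (40, 15); (41, 48); (44, 28); (49, 22)]
  [:: (9, 50); (12, 41); (16, 49); (18, 53); (30, 4); (33, 20); (34, 57);
    (35, 60); (42, 61); (44, 26); (45, 21); (46, 14); (52, 31); (54, 40);
    (56, 13); (59, 23)]
  [::].

Definition base67 := base_blocks
  [:: (14, 40)]
  [:: (13, 22); (18, 44); (20, 33); (23, 53); (25, 21); (28, 43); (32, 50);
    (33, 57); (36, 31); (37, 49); (38, 11); (43, 3); (45, 32); (46, 37);
    (48, 56)]
  [:: (7, 41); (14, 60); (20, 46); (28, 66); (34, 64); (35, 4); (36, 16);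
    (38, 51); (39, 61); (45, 59); (47, 19); (48, 29); (52, 25); (55, 23);
    (65, 42)]
  [:: (25, 43)].

Definition base79 := base_blocks
  [:: (20, 41); (31, 45)]
  [:: (13, 68); (18, 38); (23, 73); (24, 22); (25, 58); (26, 29); (28, 75);
    (29, 56); (33, 74); (39, 67); (42, 54); (43, 40); (44, 78); (47, 4);
    (49, 15); (52, 39); (57, 71); (60, 69)]
  [:: (8, 44); (11, 32); (13, 51); (16, 43); (18, 64); (21, 52); (23, 53);
    (24, 61); (26, 60); (31, 49); (35, 63); (37, 57); (42, 19); (46, 59);
    (48, 70); (62, 30); (65, 25); (72, 7)]
  [:: (19, 44); (26, 50)].

Definition base87 := base_blocks
  [:: (19, 54); (27, 55); (44, 57)]
  [:: (14, 72); (18, 43); (20, 56); (21, 82); (22, 33); (23, 64); (24, 76);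
    (25, 32); (26, 63); (31, 60); (34, 55); (37, 40); (38, 85); (40, 84);
    (45, 73); (46, 24); (48, 20); (51, 78)]
  [:: (8, 45); (9, 30); (12, 53); (13, 42); (15, 38); (16, 50); (18, 74);
    (19, 68); (23, 70); (26, 54); (31, 86); (39, 66); (46, 71); (48, 22);
    (49, 14); (51, 75); (57, 77); (62, 81); (67, 80); (69, 4); (79, 34);
    (83, 35)]
  [:: (30, 44); (36, 54)].

Definition base91 := base_blocks
  [:: (14, 78); (21, 65); (29, 63); (42, 66)]
  [:: (19, 59); (20, 7); (22, 44); (23, 68); (30, 65); (31, 73); (35, 49);
    (40, 25); (41, 75); (43, 51); (46, 72); (52, 67); (53, 33); (54, 77);
    (55, 83); (58, 31); (59, 29); (73, 86)]
  [:: (9, 63); (16, 38); (18, 46); (24, 88); (27, 48); (30, 89); (37, 85);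
    (39, 81); (41, 74); (43, 69); (47, 82); (50, 19); (52, 90); (54, 79);
    (55, 4); (56, 20); (57, 11); (58, 87); (60, 21); (62, 32); (66, 53);
    (70, 36); (80, 3); (84, 12)]
  [:: (18, 41); (24, 44)].

Definition base97 := base_blocks
  [:: (31, 69); (36, 54)]
  [:: (13, 38); (20, 65); (21, 55); (22, 70); (23, 79); (25, 77); (27, 80);
    (29, 21); (30, 67); (32, 73); (34, 61); (35, 58); (40, 51); (41, 74);
    (42, 72); (45, 69); (46, 96); (47, 87); (48, 64); (53, 39); (58, 46);
    (60, 78); (64, 62); (71, 31); (73, 93); (78, 91); (83, 35)]
  [:: (3, 59); (7, 81); (8, 32); (9, 86); (12, 47); (14, 42); (19, 68); (26,
    60); (28, 92); (43, 4); (54, 76); (63, 88); (66, 29); (75, 22); (82,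
    36); (84, 44); (90, 71); (94, 15)]
  [:: (29, 71); (30, 84); (36, 50); (38, 70); (45, 76)].

Definition base99 := base_blocks
  [:: (22, 57); (30, 76); (60, 86)]
  [:: (14, 37); (20, 95); (21, 35); (25, 8); (27, 54); (29, 96); (31, 62);
    (34, 85); (37, 80); (40, 29); (41, 32); (43, 3); (50, 97); (51, 46);
    (52, 64); (54, 33); (55, 25); (61, 55); (63, 87); (67, 86); (71, 20);
    (75, 15); (80, 84); (81, 53)]
  [:: (7, 70); (16, 49); (22, 9); (26, 40); (28, 77); (30, 60); (34, 73);
    (36, 61); (38, 66); (41, 79); (42, 83); (44, 98); (50, 18); (52, 89);
    (57, 11); (63, 21); (65, 91); (68, 13); (72, 45); (74, 92); (76, 56);
    (81, 58)]
  [:: (19, 70); (40, 64); (43, 65); (47, 68)].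

Definition base109 := base_blocks
  [:: (13, 48); (19, 72); (26, 59); (28, 55); (36, 70)]
  [:: (14, 45); (25, 14); (29, 87); (31, 60); (40, 93); (42, 99); (45, 100);
    (49, 65); (51, 75); (57, 56); (62, 84); (63, 40); (65, 107); (66, 96);
    (68, 104); (71, 68); (77, 71); (79, 19); (85, 46); (86, 72); (87, 54);
    (88, 91); (89, 8); (91, 83)]
  [:: (11, 61); (12, 38); (15, 90); (18, 66); (20, 102); (21, 64); (25, 39);
    (26, 59); (27, 52); (32, 79); (33, 97); (35, 88); (37, 105); (43, 78);
    (44, 80); (47, 34); (48, 67); (62, 41); (69, 92); (73, 13); (74, 7);
    (77, 23); (81, 63); (82, 51); (85, 4); (89, 9); (94, 50)]
  [:: (20, 58); (30, 52); (37, 77); (39, 63)].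

Definition base115 := base_blocks
  [:: (24, 38); (30, 102); (31, 90); (39, 79)]
  [:: (18, 78); (19, 43); (21, 91); (22, 56); (23, 62); (26, 7); (27, 85);
    (28, 68); (34, 83); (37, 106); (41, 104); (44, 18); (46, 93); (47, 19);
    (49, 113); (50, 29); (55, 112); (58, 81); (61, 28); (62, 99); (63, 101);
    (64, 21); (67, 108); (70, 32); (73, 67); (80, 102); (82, 51); (83, 114);
    (86, 13); (95, 59)]
  [:: (4, 75); (9, 54); (11, 86); (12, 45); (20, 111); (25, 98); (27, 76);
    (30, 92); (36, 105); (44, 26); (46, 3); (48, 74); (50, 14); (52, 80);
    (53, 88); (55, 107); (65, 15); (66, 95); (71, 33); (73, 103); (90, 35);
    (97, 16); (100, 61); (110, 8)]
  [:: (20, 41); (23, 48); (27, 84); (37, 59); (54, 101); (64, 96)].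

Definition base151 := base_blocks
  [:: (23, 97); (35, 101); (38, 96); (39, 138); (44, 70); (51, 75); (61,
    98); (109, 123)]
  [:: (19, 79); (20, 127); (21, 138); (25, 62); (27, 71); (29, 137); (30,
    94); (31, 74); (32, 9); (34, 41); (46, 73); (47, 112); (48, 81); (49,
    83); (56, 86); (60, 129); (62, 91); (63, 121); (69, 57); (71, 125); (72,
    150); (73, 88); (83, 45); (84, 38); (86, 75); (87, 20); (92, 28); (94,
    141); (106, 118); (108, 116); (110, 136); (111, 109); (115, 61); (118,
    143); (129, 147); (133, 146)]
  [:: (4, 132); (11, 96); (16, 52); (19, 93); (21, 40); (23, 104); (31,
    142); (32, 56); (35, 103); (36, 130); (39, 66); (42, 24); (46, 135);
    (48, 106); (50, 111); (51, 101); (53, 124); (59, 80); (67, 126); (68,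
    133); (70, 123); (77, 114); (82, 22); (89, 122); (90, 49); (92, 120);
    (95, 63); (98, 72); (99, 119); (100, 144); (102, 145); (110, 55); (115,
    3); (131, 85); (134, 14); (148, 76)]
  [:: (14, 63); (29, 76); (45, 87); (52, 103); (54, 84); (56, 129); (82,
    117); (113, 138)].

(** * The orders reached *)

(** Sizes of the difference families above, chosen so that the rule 3n + s leaves
    no gap from 3072 on. *)
Definition base_orders : seq nat := [:: 55; 57; 63; 67; 79; 87; 91; 97; 99; 109; 115; 151].

Inductive reached : nat -> Prop :=
| reached_zero : reached 0
| reached_base n of n \in base_orders : reached n
| reached_step n s of odd n & 1 < n & s <= n & reached n & reached s :
    reached (3 * n + s).

Fixpoint bits_or (l m : bitseq) : bitseq :=
  match l, m with
  | a :: l', b :: m' => (a || b) :: bits_or l' m'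
  | [::], _ => m
  | _, [::] => l
  end.

Lemma nth_bits_or l m i : nth false (bits_or l m) i = nth false l i || nth false m i.
Proof.
by elim: l m i => [|a l IH] [|b m] [|i] //=; rewrite ?orbF ?nth_nil.
Qed.

(** One application of the rule 3n + s, for all s <= n whose bit is set. *)
Definition extend (l : bitseq) (n : nat) : bitseq :=
  if [&& odd n, 1 < n & nth false l n] then
    bits_or l (ncons (3 * n) false (take n.+1 l))
  else l.

Definition sound (l : bitseq) := forall i, nth false l i -> reached i.

Lemma sound_extend l n : sound l -> sound (extend l n).
Proof.
move=> sl i; rewrite /extend; case: ifP => [/and3P[odd_n n_gt1 /sl Sn]|_]; last exact: sl.
rewrite nth_bits_or nth_ncons => /orP[/sl //|]; case: ltnP => // le_ni.
case: (ltnP (i - 3 * n) n.+1) => [lt_i|ge_i]; last first.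
  by rewrite nth_default // size_take; case: ifP => // /negbT; rewrite -leqNgt => /leq_trans->.
rewrite nth_take // => /sl Ss; rewrite -(subnKC le_ni); exact: reached_step.
Qed.

(** Bit 0 stands for the empty structure, used when s = 0. *)
Definition base_bits : bitseq := true :: behead (mkseq (fun i => i \in base_orders) 152).

Lemma sound_base : sound base_bits.
Proof.
move=> [_|i]; first exact: reached_zero.
rewrite /base_bits [nth _ _ _]nth_behead; case: (ltnP i.+1 152) => [lt|ge].
  by rewrite nth_mkseq //; apply: reached_base.
by rewrite nth_default // size_mkseq.
Qed.

(** Starting at a multiple of 3, the residues 0 and 1 modulo 3 are present. *)
Fixpoint covers (k : nat) (l : bitseq) : bool :=
  if k is k'.+1 then
    if l is a :: b :: _ :: l' then [&& a, b & covers k' l'] else false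
  else true.

Lemma coversP k l i : covers k l -> i < k ->
  nth false l (3 * i) /\ nth false l (3 * i).+1.
Proof.
elim: k l i => //= k IH [|a [|b [|c l]]] //= [|i] /and3P[-> -> cov] // lt_ik.
by rewrite mulnS; apply: IH.
Qed.

(** Values of n for which [extend] fills the interval needed below, in
    increasing order and given by their successive differences. *)
Definition group_sizes : seq nat := scanl addn 0
  [:: 55; 2; 6; 4; 12; 8; 4; 6; 2; 10; 6; 36; 14; 6; 18; 12; 36; 24; 12; 18;
    6; 30; 18; 108; 42; 18; 54; 36; 108; 72; 36; 54; 18; 40; 6; 2; 42; 22;
    6; 2; 16; 2; 12; 4; 2; 16; 2; 6; 4; 2; 10; 6; 8; 10; 6; 2; 6; 12; 6; 4;
    2; 10; 24; 2; 22; 2; 16; 2; 6; 4; 18; 6; 2; 22; 6; 6; 2; 30; 10; 26; 6;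
    4; 110; 54; 40; 24; 8; 6; 10; 32; 24; 16; 30; 6; 2; 48; 10; 14; 6; 22;
    8; 24; 18; 10; 96; 44; 60; 82; 42; 38; 118; 6; 132; 104; 228; 70; 42;
    24; 78; 26; 34; 98; 304].

Definition reached_bits : bitseq :=
  foldl extend base_bits group_sizes.

Lemma sound_reached_bits : sound reached_bits.
Proof.
rewrite /reached_bits; elim: group_sizes base_bits sound_base => //= a s IH l sl.
exact/IH/sound_extend.
Qed.

Lemma covers_reached_bits : covers 3100 (drop (3 * 1024) reached_bits).
Proof. by vm_compute. Qed.

Lemma reached_covered l q k i : sound l -> covers k (drop (3 * q) l) ->
  3 * q <= i < 3 * (q + k) -> i %% 3 != 2 -> reached i.
Proof.
move=> sl cov /andP[ge_i lt_i] mod_i.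
have lt_k : i %/ 3 - q < k by lia.
have [c0 c1] := coversP cov lt_k.
apply: sl; move: c0 c1; rewrite !nth_drop.
have [->|->] // : 3 * q + 3 * (i %/ 3 - q) = i \/ 3 * q + (3 * (i %/ 3 - q)).+1 = i.
by lia.
Qed.

Lemma reached_large i : 3072 <= i -> i %% 3 != 2 -> reached i.
Proof.
elim/ltn_ind: i => i IH ge_i mod_i.
case: (ltnP i (3 * (1024 + 3100))) => [lt_i|ge_i'].
  by apply: (reached_covered sound_reached_bits covers_reached_bits); rewrite ?ge_i.
(* n is odd, not congruent to 2 modulo 3 and slightly above i / 4, so that
   3072 <= i - 3n <= n. *)
pose n := 6 * (i %/ 24).+1 + 1; have iE : i = 3 * n + (i - 3 * n) by rewrite /n; lia.
rewrite iE; apply: reached_step; rewrite /n; try lia; apply: IH; lia.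
Qed.

Lemma base_attained n : n \in base_orders -> attained n.
Proof.
rewrite !inE; do 11?[case/orP]; move/eqP->.
- exact: (@attained_cyclic 55 base55).
- exact: (@attained_cyclic 57 base57).
- exact: (@attained_cyclic 63 base63).
- exact: (@attained_cyclic 67 base67).
- exact: (@attained_cyclic 79 base79).
- exact: (@attained_cyclic 87 base87).
- exact: (@attained_cyclic 91 base91).
- exact: (@attained_cyclic 97 base97).
- exact: (@attained_cyclic 99 base99).
- exact: (@attained_cyclic 109 base109).
- exact: (@attained_cyclic 115 base115).
- exact: (@attained_cyclic 151 base151).
Qed.

Lemma reached_attained n : reached n -> attained n.
Proof.
elim=> {n} [|n /base_attained //|n s odd_n n_gt1 le_sn _ Sn _ Ss].
  exists bool, pred0, (fun _ _ _ => false); split; first by rewrite card0.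
  by apply: pentagonal_empty; rewrite card0.
have [T [tri [_ [_ [_ [card_T pent _ _]]]]]] := attained_truncated odd_n n_gt1 le_sn Sn Ss.
by exists T, predT, tri.
Qed.

Theorem theorem4p2 (r : nat) :
  3396 <= r -> r = 0 %[mod 3] \/ r = 2 %[mod 3] ->
  exists (T : finType) (G : partial_linear_space T),
    [/\ PENT G 3 r 7,
        type_D G 3 7
      & forall x : T,
          has_girth (deficiency_graph G) (component (deficiency_graph G) x) 4].
Proof.
move=> ge_r mod_r.
have reached_r : reached (r + 4) by apply: reached_large; lia.
(* A value this large is not a base value: it was reached by the rule 3n + s,
   so the design has several groups and the deficiency graph is disconnected. *)
have [j eq_j] : exists j, j = r + 4 by exists (r + 4).
rewrite -eq_j in reached_r; case: reached_r eq_j.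
- by move=> eq_j; exfalso; lia.
- by move=> n base_n eq_j; exfalso; move: base_n; rewrite !inE; lia.
move=> n s odd_n n_gt1 le_sn /reached_attained Sn /reached_attained Ss eq_r.
have [T [tri [grp [x [y [card_T pent neq opp_grp]]]]]] :=
  attained_truncated odd_n n_gt1 le_sn Sn Ss.
have r_gt0 : 0 < r by apply: leq_trans ge_r.
have cardT : #|T| = r.*2 + 8 by rewrite card_T eq_r; lia.
exists T, (triple_geometry pent).
exact: (triple_geometry_type_D pent r_gt0 cardT opp_grp neq).
Qed.
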